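(* Let $(X,d)$ be a complete nonempty metric space. (1) If $\phi$ is an Oettli--Théra function on $X$, then for every Oettli--Théra element $x_0$ for $\phi$ in $X$ there exists an element $a\in B^\phi_{x_0}$ such that $B^\phi_a=\{a\}$. (2) If $\varphi$ is a Caristi--Kirk function on $X$, then for every $x\in X$ there exists $a\in B^\varphi_x$ such that $B^\varphi_a=\{a\}$.
   Context: A Caristi--Kirk function on $X$ is a function $\varphi:X\to\mathbb{R}$ that is lower semicontinuous and bounded from below; its balls are $B^\varphi_x=\{y\in X\mid d(x,y)\le\varphi(x)-\varphi(y)\}$ for $x\in X$. An Oettli--Théra function on $X$ is a function $\phi:X\times X\to(-\infty,+\infty]$ such that: (a) $\phi(x,\cdot)$ is lower semicontinuous for all $x\in X$; (b) $\phi(x,x)=0$ for all $x\in X$; (c) $\phi(x,y)\le\phi(x,z)+\phi(z,y)$ for all $x,y,z\in X$; (d) there exists $x_0\in X$ such that $\inf_{x\in X}\phi(x_0,x)>-\infty$. An element $x_0\in X$ satisfying the property in (d) is called an Oettli--Théra element for $\phi$ in $X$. The balls of $\phi$ are $B^\phi_x=\{y\in X\mid d(x,y)\le-\phi(x,y)\}$ for $x\in X$. *)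

(* Defs.v *)
From HB Require Import structures.
From mathcomp Require Import all_boot all_order all_algebra.
From mathcomp Require Import all_classical all_reals all_analysis.

Set Implicit Arguments.
Unset Strict Implicit.
Unset Printing Implicit Defensive.

Import Order.TTheory GRing.Theory Num.Theory.
Import numFieldNormedType.Exports.

Local Open Scope classical_set_scope.
Local Open Scope ring_scope.

(* [Complete] extends [Pointed], so these are the nonempty complete metric
   spaces; completeness is convergence of all proper Cauchy filters. *)
#[short(type="completeMetricType")]
HB.structure Definition CompleteMetric (R : numDomainType) :=
  {T of Metric R T & Complete T}.

Section CaristiKirk.
Context {R : realType} {X : metricType R}.

Definition caristi_kirk (phi : X -> R) : Prop :=
  lower_semicontinuous (fun x => (phi x)%:E) /\ has_lbound (range phi).

Definition caristi_kirk_ball (phi : X -> R) (x : X) : set X :=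
  [set y | mdist x y <= phi x - phi y].

End CaristiKirk.

Section OettliThera.
Context {R : realType} {X : metricType R}.
Local Open Scope ereal_scope.

Definition oettli_thera_element (phi : X -> X -> \bar R) (x0 : X) : Prop :=
  -oo < ereal_inf (range (phi x0)).

Record oettli_thera (phi : X -> X -> \bar R) : Prop := OettliThera {
  oettli_thera_gtNy : forall x y, -oo < phi x y;
  oettli_thera_lsc : forall x, lower_semicontinuous (phi x);
  oettli_thera_diag : forall x, phi x x = 0;
  oettli_thera_triangle : forall x y z, phi x y <= phi x z + phi z y;
  oettli_thera_ex : exists x0, oettli_thera_element phi x0 }.

Definition oettli_thera_ball (phi : X -> X -> \bar R) (x : X) : set X :=
  [set y | (mdist x y)%:E <= - phi x y].

End OettliThera.

(* Main.v *)
Require Import Defs.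
From mathcomp Require Import all_boot all_order all_algebra.
From mathcomp Require Import all_classical all_reals all_analysis.
From mathcomp Require Import lra.

Set Implicit Arguments.
Unset Strict Implicit.
Unset Printing Implicit Defensive.

Import Order.TTheory GRing.Theory Num.Theory.

Local Open Scope classical_set_scope.
Local Open Scope ring_scope.

(** Writing [B x] for the balls, the triangle inequality makes them nested:
    [y \in B x] implies [B y `<=` B x].  They are closed by lower
    semicontinuity, and they contain their centres.  The one quantitative
    point is that every [B x] inside [B x0] contains balls of arbitrarily small
    radius: if [y \in B x] minimises the function [phi x0] over [B x] up to [e],
    then for [z \in B y] the triangle inequality gives
    [mdist y z <= - phi y z <= phi x0 y - phi x0 z <= e]
    (lemma [oettli_thera_ball_small]).

    For any family of sets with these properties ([exists_singleton_ball]), one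
    chooses [u (n+1) \in B (u n)] with [B (u (n+1))] of radius at most
    [1 / (n+1)].  As in Cantor's intersection theorem, the sequence [u]
    converges to a point [a] of every [B (u n)]; by nestedness [B a] lies in
    every [B (u n)] too, so every point of [B a] is a limit of [u], hence is
    [a].

    A Caristi--Kirk function [phi] reduces to the Oettli--Thera function
    [(x, y) |-> phi y - phi x]: it has the same balls, and every point is an
    Oettli--Thera element for it. *)

Section NestedBalls.
Context {R : realType} {X : completeMetricType R}.

(** A variant of Cantor's intersection theorem for balls attached to points:
    the intersection of a shrinking chain of balls is a singleton, and it
    contains the ball of its own point. *)
Lemma exists_singleton_ball (B : X -> set X) (x0 : X) :
  (forall x, B x x) ->
  (forall x y, B x y -> B y `<=` B x) ->
  (forall x, closed (B x)) ->
  (forall x (e : R), B x0 x -> 0 < e ->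
     exists2 y, B x y & forall z, B y z -> mdist y z <= e) ->
  exists a, B x0 a /\ B a = [set a].
Proof.
move=> Bxx Bnest Bclosed Bsmall.
have /choice[f fP] (p : nat * X) : exists y, B x0 p.2 ->
    B p.2 y /\ forall z, B y z -> mdist y z <= p.1.+1%:R^-1.
  have [x0p|] := pselect (B x0 p.2); last by exists p.2.
  have [||y py sy] := Bsmall p.2 p.1.+1%:R^-1; rewrite ?invr_gt0//.
  by exists y.
pose u := fix u n := if n is m.+1 then f (m, u m) else x0.
have x0u n : B x0 (u n).
  by elim: n => [//|n IH]; apply: (Bnest _ _ IH); exact: (fP (n, u n) IH).1.
have uS n : B (u n) (u n.+1) by exact: (fP (n, u n) (x0u n)).1.
have usmall n z : B (u n.+1) z -> mdist (u n.+1) z <= n.+1%:R^-1.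
  exact: (fP (n, u n) (x0u n)).2.
have u_le n m : (n <= m)%N -> B (u n) (u m).
  move=> /subnKC <-; elim: (m - n)%N => [|k IH]; first by rewrite addn0.
  by rewrite addnS; apply: (Bnest _ _ IH).
have small_n (e : R) : 0 < e -> exists n, n.+1%:R^-1 < e.
  move=> e0; have [n _ /(_ n (leqnn n))] := near_infty_natSinv_lt (PosNum e0).
  by exists n.
have ucvg : cvg (u @ \oo).
  apply: cauchy_cvg; apply: cauchy_exP => e /small_n[n ne].
  exists (u n.+1); exists n.+1 => // m /= nm.
  by rewrite ballEmdist /=; exact: le_lt_trans (usmall _ _ (u_le _ _ nm)) ne.
set a := lim (u @ \oo).
have Ba n : B (u n) a.
  apply: (closed_cvg (B (u n)) _ _ _ ucvg); first exact: Bclosed.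
  by exists n => // m; exact: u_le.
(* A point common to all the balls is within [2 / (n+1)] of [u m] for [m > n]. *)
have u_to z : (forall n, B (u n) z) -> u @ \oo --> z.
  move=> Bz; apply/cvg_ballP => e e0.
  have [n ne] := small_n (e / 2) (divr_gt0 e0 (ltr0Sn _ _)).
  exists n.+1 => // m /= nm; rewrite ballEmdist /=.
  rewrite (le_lt_trans (metric_triangle _ (u n.+1) _))// (splitr e) ltrD//.
    by rewrite metric_sym (le_lt_trans (usmall _ _ (Bz _))).
  by rewrite (le_lt_trans (usmall _ _ (u_le _ _ nm))).
exists a; split; first exact: (Ba 0%N).
apply/seteqP; split=> [y ay|_ ->//] /=.
have uy : u @ \oo --> y by apply: u_to => n; exact: (Bnest _ _ (Ba n)).
exact: (cvg_unique (@metric_hausdorff _ X) uy ucvg).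
Qed.

End NestedBalls.

Section OettliTheraBalls.
Context {R : realType} {X : metricType R}.
Variables (phi : X -> X -> \bar R) (phiOT : oettli_thera phi).

(** Values of [phi] inside a ball are real, being above [-oo] and at most [0];
    this moves all further estimates from extended reals to reals. *)
Lemma oettli_thera_ballP x y : oettli_thera_ball phi x y <->
  exists2 r : R, phi x y = r%:E & mdist x y <= - r.
Proof.
rewrite /oettli_thera_ball /=; split=> [|[r -> //]].
have := oettli_thera_gtNy phiOT x y.
by case: (phi x y) => [r| |]//= _; rewrite -?EFinN ?lee_fin; first exists r.
Qed.

Lemma oettli_thera_ball_center x : oettli_thera_ball phi x x.
Proof.
by apply/oettli_thera_ballP; exists 0; rewrite ?oettli_thera_diag ?mdistxx ?oppr0.
Qed.

Lemma oettli_thera_ball_nested x y : oettli_thera_ball phi x y ->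
  oettli_thera_ball phi y `<=` oettli_thera_ball phi x.
Proof.
move=> /oettli_thera_ballP[p xyp dp] z /oettli_thera_ballP[q yzq dq].
have := oettli_thera_triangle phiOT x z y; rewrite xyp yzq -EFinD.
rewrite /oettli_thera_ball/= leeNr -EFinN => /le_trans; apply.
by rewrite lee_fin; have := metric_triangle x y z; lra.
Qed.

(** If [- phi x z < mdist x z], a real [r] strictly between [- mdist x z] and
    [phi x z] leaves room to move [z]: near [z], both [r < phi x y] by lower
    semicontinuity and [- mdist x y < r] by continuity of the distance. *)
Lemma oettli_thera_ball_closed x : closed (oettli_thera_ball phi x).
Proof.
move=> z clz; rewrite /oettli_thera_ball/= leNgt; apply/negP => dz.
have [r dr rz] : exists2 r : R, - mdist x z < r & (r%:E < phi x z)%E.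
  move: (oettli_thera_gtNy phiOT x z) dz.
  case: (phi x z) => [s| |]//= _; last first.
    by exists (1 - mdist x z); [lra|rewrite ltry].
  rewrite lte_fin => ds.
  by exists ((s - mdist x z) / 2); rewrite ?lte_fin; lra.
have e0 : 0 < mdist x z + r by lra.
have nz : nbhs z ([set y | r%:E < phi x y]%E `&` ball z (mdist x z + r)).
  have [V zV Vr] := oettli_thera_lsc phiOT rz.
  by apply: filterI; [exact: filterS Vr zV|exact: (nbhsx_ballx _ _ e0)].
have [y [/oettli_thera_ballP[s xys ds] [/=]]] := clz _ nz.
rewrite xys lte_fin ballEmdist/= metric_sym => rs.
by have := metric_triangle x y z; lra.
Qed.

(** The centre [y] is an [e]-minimiser of [phi x0] over the ball of [x],
    which exists because [phi x0] is bounded from below. *)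
Lemma oettli_thera_ball_small x0 x (e : R) : oettli_thera_element phi x0 ->
  oettli_thera_ball phi x0 x -> 0 < e ->
  exists2 y, oettli_thera_ball phi x y &
    forall z, oettli_thera_ball phi y z -> mdist y z <= e.
Proof.
move=> x0P x0x e0.
pose S := phi x0 @` oettli_thera_ball phi x.
have Sfin : ereal_inf S \is a fin_num.
  have /oettli_thera_ballP[r x0xr _] := x0x.
  rewrite fin_numElt; apply/andP; split.
    apply: (lt_le_trans x0P); apply: ereal_inf_le_tmp.
    by move=> _ [y _ <-]; exists y.
  apply: (@le_lt_trans _ _ (phi x0 x)); last by rewrite x0xr ltry.
  by apply: ereal_inf_lbound; exists x => //; exact: oettli_thera_ball_center.
have [_ [y xy <-] yinf] := lb_ereal_inf_adherent e0 Sfin.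
exists y => // z yz; have xz := oettli_thera_ball_nested xy yz.
have Sz : (ereal_inf S <= phi x0 z)%E by apply: ereal_inf_lbound; exists z.
have /oettli_thera_ballP[p x0yp _] := oettli_thera_ball_nested x0x xy.
have /oettli_thera_ballP[q x0zq _] := oettli_thera_ball_nested x0x xz.
have /oettli_thera_ballP[r yzr dr] := yz.
have := oettli_thera_triangle phiOT x0 z y.
move: yinf Sz; rewrite -(fineK Sfin) x0yp x0zq yzr -!EFinD lte_fin !lee_fin.
by lra.
Qed.

End OettliTheraBalls.

Section CaristiKirkBalls.
Context {R : realType} {X : metricType R}.
Variables (phi : X -> R) (phiCK : caristi_kirk phi).

Let psi (x y : X) : \bar R := (phi y - phi x)%:E.

Lemma caristi_kirk_oettli_thera_element x : oettli_thera_element psi x.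
Proof.
have [_ [m mP]] := phiCK.
apply: (@lt_le_trans _ _ (m - phi x)%:E); first exact: ltNyr.
apply: le_ereal_inf_tmp => _ [y _ <-]; rewrite lee_fin lerD2r.
by apply: mP; exists y.
Qed.

Lemma caristi_kirk_oettli_thera (x : X) : oettli_thera psi.
Proof.
split.
- by move=> y z; exact: ltNyr.
- move=> y z b; rewrite lte_fin => bz.
  have [|V zV VP] := phiCK.1 z (b + phi y); first by rewrite lte_fin; lra.
  by exists V => // t /VP; rewrite !lte_fin; lra.
- by move=> y; rewrite /psi subrr.
- by move=> y z t; rewrite -EFinD lee_fin; lra.
- by exists x; exact: caristi_kirk_oettli_thera_element.
Qed.

Lemma caristi_kirk_ballE x :
  caristi_kirk_ball phi x = oettli_thera_ball psi x.
Proof.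
by apply/seteqP; split=> y;
  rewrite /caristi_kirk_ball /oettli_thera_ball /= lee_fin opprB.
Qed.

End CaristiKirkBalls.

Theorem proposition15 (R : realType) (X : completeMetricType R) :
  (forall phi : X -> X -> \bar R, oettli_thera phi ->
     forall x0 : X, oettli_thera_element phi x0 ->
       exists a : X, oettli_thera_ball phi x0 a /\
                     oettli_thera_ball phi a = [set a]) /\
  (forall phi : X -> R, caristi_kirk phi ->
     forall x : X,
       exists a : X, caristi_kirk_ball phi x a /\
                     caristi_kirk_ball phi a = [set a]).
Proof.
have OT (phi : X -> X -> \bar R) : oettli_thera phi ->
    forall x0 : X, oettli_thera_element phi x0 ->
    exists a : X, oettli_thera_ball phi x0 a /\
                  oettli_thera_ball phi a = [set a].
  move=> phiOT x0 x0P; apply: exists_singleton_ball.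
  - exact: oettli_thera_ball_center.
  - exact: oettli_thera_ball_nested.
  - exact: oettli_thera_ball_closed.
  - by move=> x e; exact: oettli_thera_ball_small.
split=> // phi phiCK x.
have [a [xa aa]] := OT _ (caristi_kirk_oettli_thera phiCK x) x
  (caristi_kirk_oettli_thera_element phiCK x).
by exists a; rewrite !caristi_kirk_ballE.
Qed.
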